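(* Let $E,E'\in\mathcal M(J,\{n_k\},\{r_k\})$ be two Moran sets with $r=\inf_kr_k>0$, with Moran structures $\{J_{\mathbf i}:\mathbf i\in D\}$ and $\{J'_{\mathbf i}:\mathbf i\in D\}$ respectively. Suppose each of the two structures satisfies the following separation condition (stated for $\{J_{\mathbf i}\}$): there is a constant $C'>0$ such that for any $n\ge1$ and $\mathbf u,\mathbf v\in X_n$, either $J_{\mathbf u}\cap J_{\mathbf v}\ne\emptyset$ or $\operatorname{dist}(J_{\mathbf u},J_{\mathbf v})\ge C'r^n$. Assume that the augmented trees induced by $E$ and by $E'$ are both rearrangeable. Then $E$ and $E'$ are Lipschitz equivalent, i.e. there are a bijection $\tau:E\to E'$ and a constant $C>0$ such that $C^{-1}|x-y|\le|\tau(x)-\tau(y)|\le C|x-y|$ for all $x,y\in E$.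
   Context: **Moran sets.** Let $\{n_k\}_{k\ge1}$ be positive integers and $\{r_k\}_{k\ge1}$ positive numbers with $n_k\ge2$, $0<r_k<1$, $n_kr_k\le1$. Let $D_0=\{\emptyset\}$ (the empty word), $D_k=\prod_{j=1}^k\{1,\dots,n_j\}$, $D=\bigcup_{k\ge0}D_k$; concatenation of words is denoted by juxtaposition. $|A|$ denotes the diameter of a set $A$, $\operatorname{dist}$ the Euclidean distance between sets, $\#$ cardinality. Let $J\subset\mathbb R^d$ be compact with nonempty interior. A collection $\{J_{\mathbf i}:\mathbf i\in D\}$ of subsets of $J$ has the Moran structure if: (1) $J_\emptyset=J$; (2) for each $\mathbf i\in D$ there is a similarity $S_{\mathbf i}:\mathbb R^d\to\mathbb R^d$ with $J_{\mathbf i}=S_{\mathbf i}(J)$; (3) for every $k\ge1$ and $\mathbf i\in D_{k-1}$, the sets $J_{\mathbf i1},\dots,J_{\mathbf in_k}$ are subsets of $J_{\mathbf i}$ with pairwise disjoint interiors; (4) for every $k\ge1$, $\mathbf i\in D_{k-1}$, $1\le j\le n_k$, $|J_{\mathbf ij}|/|J_{\mathbf i}|=r_k$. The set $E=\bigcap_{k\ge0}\bigcup_{\mathbf i\in D_k}J_{\mathbf i}$ is the Moran set, and $\mathcal M(J,\{n_k\},\{r_k\})$ is the class of all such sets. **Induced augmented tree.** Let $r=\inf_kr_k>0$. Put $X_0=\{\emptyset\}$ and, for $n\ge1$, $X_n=\{i_1\cdots i_k\in D: r_1\cdots r_k\le r^n<r_1\cdots r_{k-1}\}$ (for $k=1$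 the empty product is $1$). Let $X=\bigcup_{n\ge0}X_n$. For $n\ge1$ each $\mathbf u\in X_n$ has a unique prefix $\mathbf u^{-1}\in X_{n-1}$ (its parent; $\mathbf u$ is an offspring of $\mathbf u^{-1}$). The vertical edges $\mathcal E_v$ join $\mathbf u^{-1}$ and $\mathbf u$ for $\mathbf u\in X\setminus\{\emptyset\}$. The horizontal edges $\mathcal E_h$ join $\mathbf u\ne\mathbf v$ in the same $X_n$, $n\ge1$, with $J_{\mathbf u}\cap J_{\mathbf v}\neq\emptyset$. With $\mathcal E=\mathcal E_v\cup\mathcal E_h$, $(X,\mathcal E)$ is the augmented tree induced by $E$. **Rearrangeable.** A horizontal connected component is a maximal connected horizontal subgraph on some level $X_n$, i.e. (the vertex set of) a connected component of $X_n$ with the edges of $\mathcal E_h$; let $\mathscr C$ be the set of all of them, over all $n$. All words in $X_n$ have the same set $\Sigma_n$ of suffixes leading to their offsprings in $X_{n+1}$. For $T\in\mathscr C$ lying in level $n$, let $T\Sigma_n=\{\mathbf{ui}\in X_{n+1}:\mathbf u\in T,\ \mathbf i\in\Sigma_n\}$ be the set of offsprings of $T$. The augmented tree is rearrangeable if $\max\{\#T:T\in\mathscr C\}<\infty$ and, for every $n$ and every $T\in\mathscr C$ in level $n$ with $\#T=b$, the set $T\Sigma_n$ can be decomposed into $b$ (disjoint) groups $$T\Sigma_n=\Big(\bigcup_{k\in\Lambda_1}Z_k\Big)\cup\cdots\cup\Big(\bigcup_{k\in\Lambda_b}Z_k\Big)$$ where the $Z_k\in\mathscr C$ are the distinct horizontal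 connected components consisting of offsprings of $T$, and every group has total size $\sum_{k\in\Lambda_s}\#Z_k=\#\Sigma_n$, $s=1,\dots,b$. *)

(* Defs.v *)
From mathcomp Require Import all_boot all_order all_algebra.
From mathcomp Require Import finmap.
From mathcomp Require Import all_classical all_reals all_analysis.
From Stdlib Require Import Relation_Operators.

Set Implicit Arguments.
Unset Strict Implicit.
Unset Printing Implicit Defensive.

Import Order.TTheory GRing.Theory Num.Theory.
Import numFieldNormedType.Exports.

Local Open Scope classical_set_scope.
Local Open Scope ring_scope.

(* R^d is 'rV[R]_d. Its library norm is the sup norm, so the Euclidean metric
   is defined here; the two induce the same topology, and [compact] and
   [interior] are therefore the library's. *)
Section Euclidean.
Variables (R : realType) (d : nat).
Implicit Types (x y : 'rV[R]_d) (A B : set 'rV[R]_d).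

Definition eucl_dist x y : R := Num.sqrt (\sum_(i < d) (x 0 i - y 0 i) ^+ 2).

Definition diameter A : R :=
  sup [set eucl_dist p.1 p.2 | p in A `*` A].

Definition set_dist A B : R :=
  inf [set eucl_dist p.1 p.2 | p in A `*` B].

Definition similarity (S : 'rV[R]_d -> 'rV[R]_d) : Prop :=
  exists2 c : R, 0 < c &
    forall x y, eucl_dist (S x) (S y) = c * eucl_dist x y.

Definition lipschitz_equivalent A B : Prop :=
  exists2 tau : 'rV[R]_d -> 'rV[R]_d, set_bij A B tau &
    exists2 C : R, 0 < C &
      forall x y, A x -> A y ->
        C^-1 * eucl_dist x y <= eucl_dist (tau x) (tau y) <= C * eucl_dist x y.

End Euclidean.

(* The cardinality of a finite set; the value is 0 on infinite sets. *)
Definition card_set (T : choiceType) (A : set T) : nat := #|` fset_set A|.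

Notation word := (seq nat).

(* Sequences are indexed from 1: the values n_ 0 and r_ 0 are never used. *)
Definition words (n_ : nat -> nat) (k : nat) : set word :=
  [set w | size w = k /\
           forall j, (j < k)%N -> (1 <= nth 0%N w j <= n_ j.+1)%N].

Definition all_words (n_ : nat -> nat) : set word :=
  \bigcup_(k in [set: nat]) words n_ k.

Record moran_data (R : realType) (n_ : nat -> nat) (r_ : nat -> R) : Prop := {
  moran_n_ge2 : forall k, (1 <= k)%N -> (2 <= n_ k)%N;
  moran_r_itv : forall k, (1 <= k)%N -> 0 < r_ k < 1;
  moran_nr_le1 : forall k, (1 <= k)%N -> (n_ k)%:R * r_ k <= 1
}.

(* Only the values of [Jf] on [all_words n_] matter. *)
Record moran_structure (R : realType) (d : nat) (J : set 'rV[R]_d)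
    (n_ : nat -> nat) (r_ : nat -> R) (Jf : word -> set 'rV[R]_d) : Prop := {
  moran_sub : forall w, all_words n_ w -> Jf w `<=` J;
  moran_root : Jf [::] = J;
  moran_similar : forall w, all_words n_ w ->
    exists2 S : 'rV[R]_d -> 'rV[R]_d, similarity S & Jf w = S @` J;
  moran_nested : forall k w j, (1 <= k)%N -> words n_ k.-1 w ->
    (1 <= j <= n_ k)%N -> Jf (rcons w j) `<=` Jf w;
  moran_disjoint : forall k w j j', (1 <= k)%N -> words n_ k.-1 w ->
    (1 <= j <= n_ k)%N -> (1 <= j' <= n_ k)%N -> j != j' ->
    interior (Jf (rcons w j)) `&` interior (Jf (rcons w j')) = set0;
  moran_ratio : forall k w j, (1 <= k)%N -> words n_ k.-1 w ->
    (1 <= j <= n_ k)%N -> diameter (Jf (rcons w j)) / diameter (Jf w) = r_ k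
}.

Definition moran_set (R : realType) (d : nat) (n_ : nat -> nat)
    (Jf : word -> set 'rV[R]_d) : set 'rV[R]_d :=
  \bigcap_(k in [set: nat]) \bigcup_(w in words n_ k) Jf w.

Definition inf_ratio (R : realType) (r_ : nat -> R) : R :=
  inf [set r_ k | k in [set k | (1 <= k)%N]].

Section AugmentedTree.
Variables (R : realType) (d : nat) (n_ : nat -> nat) (r_ : nat -> R).
Variable Jf : word -> set 'rV[R]_d.

Definition level (n : nat) : set word :=
  if n is 0 then [set [::]]
  else [set w | [/\ all_words n_ w, (1 <= size w)%N &
         \prod_(1 <= j < (size w).+1) r_ j <= inf_ratio r_ ^+ n
           < \prod_(1 <= j < size w) r_ j]].

Definition horizontal_edge (n : nat) (u v : word) : Prop :=
  [/\ (1 <= n)%N, level n u, level n v, u <> v & Jf u `&` Jf v !=set0].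

Definition component (n : nat) (u : word) : set word :=
  [set v | level n v /\ clos_refl_trans word (horizontal_edge n) u v].

Definition components (n : nat) : set (set word) :=
  [set component n u | u in level n].

Definition suffixes (n : nat) : set word :=
  [set i | exists2 u, level n u & level n.+1 (u ++ i)].

Definition offspring (n : nat) (T : set word) : set word :=
  [set v | level n.+1 v /\
     exists u i, [/\ T u, suffixes n i & v = u ++ i]].

(* [Z] enumerates without repetition the p components consisting of offsprings
   of [T], and the s-th group is indexed by [Lam s]. *)
Definition rearrangeable_component (n : nat) (T : set word) : Prop :=
  exists (p : nat) (Z : 'I_p -> set word)
         (Lam : 'I_(card_set T) -> {set 'I_p}),
    [/\ injective Z,
        range Z = [set A | components n.+1 A /\ A `<=` offspring n T],
        trivIset [set: 'I_(card_set T)] (fun s => [set` Lam s]),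
        offspring n T =
          \bigcup_(s in [set: 'I_(card_set T)]) \bigcup_(k in [set` Lam s]) Z k
      & forall s, (\sum_(k in Lam s) card_set (Z k))%N
                  = card_set (suffixes n)].

Definition rearrangeable : Prop :=
  (exists M : nat, forall n T, components n T ->
     finite_set T /\ (card_set T <= M)%N) /\
  (forall n T, components n T -> rearrangeable_component n T).

Definition separation_condition : Prop :=
  exists2 C : R, 0 < C &
    forall n u v, (1 <= n)%N -> level n u -> level n v ->
      Jf u `&` Jf v !=set0 \/ C * inf_ratio r_ ^+ n <= set_dist (Jf u) (Jf v).

End AugmentedTree.

(* Main.v *)
Require Import Defs.
From mathcomp Require Import all_boot all_order all_algebra.
From mathcomp Require Import finmap.
From mathcomp Require Import all_classical all_reals all_analysis.
From Stdlib Require Import Relation_Operators.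
Set Implicit Arguments.
Unset Strict Implicit.
Unset Printing Implicit Defensive.

Import Order.TTheory GRing.Theory Num.Theory.
Import numFieldNormedType.Exports.
Local Open Scope classical_set_scope.
Local Open Scope ring_scope.

(** Both Moran sets are bi-Lipschitz images of one symbolic space, so they are
    Lipschitz equivalent to each other.

    A word belongs to the level [X_n] exactly when it has a certain length
    [K n] ([level_lengths]), and its cell has diameter at most [r ^ n |J|].
    The number of offspring of a vertex of [X_n] is therefore the same number
    [N_n] for all of them, and it depends only on [n_] and [r_]. The symbolic
    space is the set of sequences [s] with [s n < N_n], where two sequences
    that first differ at the index [n] are regarded as being at distance [r ^ n].

    Points of the Moran set correspond to decreasing sequences of horizontal
    components. A component has at most [M] cells, so its diameter is at most
    of the order of [r ^ n]; cells of distinct components do not meet, so by the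
    separation condition they are at distance at least of the order of [r ^ n].
    Thus the distance of two points is comparable to [r ^ n], for [n] the first
    level where their components differ.

    What rearrangeability adds is that this tree of components can be coded by
    the digits above. Let [T] be a component of level [n] with [b] vertices. Its
    offspring fall into [b] groups of [N_n] vertices, and no component of level
    [n + 1] meets two groups. Attach the groups to the vertices of [T], and let
    [ch n u i] be the [i]-th member of the group of [u]
    ([rearranged_children]). In the resulting tree every vertex has [N_n]
    children as before, a child of [u] lies over the component of [u], and
    children of distinct vertices lie in distinct components. A digit sequence
    [s] traces a branch [W s n] of this tree. The components of the [W s n] are
    nested, so their cells have exactly one common point, the point coded by
    [s]. Equality of the first [n] digits forces equality of the components at
    level [n] ([codes_upper_bound]). Conversely, if the components of [W s] and
    [W t] agree at level [n + 1], then [W s n = W t n], so different digits at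
    the index [n] separate the components at level [n + 2]
    ([codes_lower_bound]). Hence the coding is a bijection with the required
    distance bounds ([codes_metric_coding]), and the composition of the coding
    of one set with the inverse of the coding of the other is bi-Lipschitz
    ([metric_coding_lipschitz]). *)

(** * Euclidean distance and the sup norm *)

Section EuclideanDistance.
Context {R : realType} {d : nat}.
Implicit Types (x y : 'rV[R]_d) (A B J : set 'rV[R]_d).

Lemma eucl_dist_ge0 x y : 0 <= eucl_dist x y.
Proof. exact: sqrtr_ge0. Qed.

Lemma eucl_dist_xx x : eucl_dist x x = 0.
Proof.
by rewrite /eucl_dist big1 ?sqrtr0// => i _; rewrite subrr expr0n.
Qed.

Lemma norm_le_eucl_dist x y : `|x - y| <= eucl_dist x y.
Proof.
rewrite [leLHS]mx_normrE; apply: bigmax_le => [|[i j] _ /=].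
  exact: eucl_dist_ge0.
rewrite -sqrtr_sqr ler_wsqrtr// [i]ord1 !mxE (bigD1 j)//= lerDl.
by apply: sumr_ge0 => k _; rewrite sqr_ge0.
Qed.

Lemma eucl_dist_le_norm x y : eucl_dist x y <= d%:R * `|x - y|.
Proof.
have coord i : `|x 0 i - y 0 i| <= `|x - y|.
  have := le_bigmax 0 (fun ij : 'I_1 * 'I_d => `|(x - y) ij.1 ij.2|) (0, i).
  by rewrite /= !mxE => /le_trans->//; rewrite [leRHS]mx_normrE.
have dxy0 : 0 <= d%:R * `|x - y| by rewrite mulr_ge0.
rewrite -[leRHS]ger0_norm// -sqrtr_sqr ler_wsqrtr//.
apply: (@le_trans _ _ (\sum_(i < d) `|x - y| ^+ 2)).
  by apply: ler_sum => i _; rewrite -real_normK ?num_real// lerXn2r ?nnegrE.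
rewrite sumr_const card_ord exprMn -[leLHS]mulr_natl ler_wpM2r ?sqr_ge0//.
by rewrite -natrX ler_nat; case: d => // k; rewrite leq_pmulr.
Qed.

Lemma eucl_dist_eq0 x y : eucl_dist x y <= 0 -> x = y.
Proof.
move=> xy0; apply/eqP; rewrite -subr_eq0 -normr_le0.
exact: le_trans (norm_le_eucl_dist x y) xy0.
Qed.

Lemma eucl_dist_le_diameter J A x y : compact J -> A `<=` J ->
  A x -> A y -> eucl_dist x y <= diameter A.
Proof.
move=> /compact_bounded[M [_ Mb]] AJ Ax Ay.
apply: ub_le_sup; last by exists (x, y).
exists (d%:R * ((M + 1) + (M + 1))) => _ [[u v] [/= Au Av] <-].
apply: (le_trans (eucl_dist_le_norm u v)); rewrite ler_wpM2l//.
by apply: (le_trans (ler_normB u v)); apply: lerD; apply: (Mb (M + 1));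
  rewrite ?ltrDl//; apply: AJ.
Qed.

Lemma set_dist_le A B x y : A x -> B y -> set_dist A B <= eucl_dist x y.
Proof.
move=> Ax By; apply: ge_inf; last by exists (x, y).
by exists 0 => _ [[u v] _ <-]; exact: eucl_dist_ge0.
Qed.

(** A similarity is Lipschitz for the Euclidean distance, hence continuous for
    the norm, which is equivalent to it. *)
Lemma similarity_continuous (S : 'rV[R]_d -> 'rV[R]_d) :
  similarity S -> continuous S.
Proof.
move=> [c c0 Sc] x; apply/(@cvgrPdist_le _ _ _ _ (nbhs_filter x)) => e e0.
have cd0 : 0 < c * d%:R + 1 by rewrite ltr_wpDl// mulr_ge0// ltW.
near=> y.
apply: (le_trans (norm_le_eucl_dist (S x) (S y))); rewrite Sc.
apply: (@le_trans _ _ ((c * d%:R + 1) * `|x - y|)).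
  apply: (@le_trans _ _ (c * (d%:R * `|x - y|))).
    by rewrite ler_wpM2l ?(ltW c0)// eucl_dist_le_norm.
  by rewrite mulrA mulrDl lerDl mul1r.
rewrite mulrC -ler_pdivlMr//; near: y.
by apply: (@cvgr_dist_le _ _ _ _ (nbhs_filter x) idfun x);
  [exact: cvg_id|exact: divr_gt0].
Unshelve. all: by end_near. Qed.

Lemma similarity_compact (S : 'rV[R]_d -> 'rV[R]_d) J :
  similarity S -> compact J -> compact (S @` J).
Proof.
move=> simS cJ; apply: continuous_compact => //.
exact/continuous_subspaceT/similarity_continuous.
Qed.

End EuclideanDistance.

(** * Coding by digit sequences *)

Section Codings.
Context {R : realType} {d : nat}.
Implicit Types (A : set 'rV[R]_d) (D : set (nat -> nat)).

(** [pi] is bi-Lipschitz from the ultrametric in which sequences that first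
    differ at [n] are at distance [x ^+ n]. In the lower bound [n] may be any
    index of difference, which is the same requirement when [0 <= x <= 1]. *)
Definition metric_coding D A (x : R) (pi : (nat -> nat) -> 'rV[R]_d) : Prop :=
  set_bij D A pi /\
  exists c1 c2 : R, [/\ 0 < c1, 0 < c2,
    forall s t n, D s -> D t -> (forall m, (m < n)%N -> s m = t m) ->
      eucl_dist (pi s) (pi t) <= c1 * x ^+ n
  & forall s t n, D s -> D t -> s n <> t n ->
      c2 * x ^+ n <= eucl_dist (pi s) (pi t)].

Lemma first_difference (s t : nat -> nat) : s <> t ->
  exists n, s n <> t n /\ forall m, (m < n)%N -> s m = t m.
Proof.
move=> st; have exn : exists n, s n != t n.
  apply: contrapT => eqst; apply: st; apply/funext => n.
  by apply: contrapT => /eqP stn; apply: eqst; exists n.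
case: (ex_minnP exn) => n /eqP stn nmin; exists n; split=> // m.
by rewrite ltnNge => /negP mn; apply/eqP; apply: contra_notT mn; exact: nmin.
Qed.

(** At the first index where the codes of two points differ, both distances are
    comparable to the same power of [x]. *)
Lemma metric_coding_lipschitz D A A' (x : R) pi pi' : 0 < x ->
  metric_coding D A x pi -> metric_coding D A' x pi' ->
  lipschitz_equivalent A A'.
Proof.
move=> x0 [[piA piI piS] [c1 [c2 [c10 c20 up lo]]]].
move=> [[piA' piI' piS'] [c1' [c2' [c10' c20' up' lo']]]].
have /choice[code codeP] : forall y, exists s, A y -> D s /\ pi s = y.
  move=> y; have [/piS[s Ds <-]|nAy] := pselect (A y); first by exists s.
  by exists (fun=> 0%N).
have bound (a1 a2 a1' a2' : R) n (C : R) u v : 0 < a1' -> 0 < a2 ->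
    a1' / a2 <= C -> a2 * x ^+ n <= u -> v <= a1' * x ^+ n -> v <= C * u.
  move=> a10 a20 aC au va; apply: (le_trans va).
  have -> : a1' * x ^+ n = a1' / a2 * (a2 * x ^+ n).
    by rewrite mulrA divfK// gt_eqF.
  by rewrite ler_pM// mulr_ge0// ltW// ?invr_gt0// exprn_gt0.
exists (fun y => pi' (code y)); first split.
- by move=> y /codeP[Ds _]; exact: piA'.
- move=> y z; rewrite !inE => Ay Az e.
  have [Dy <-] := codeP _ Ay; have [Dz <-] := codeP _ Az.
  by congr pi; apply: piI' e; rewrite inE.
- move=> _ /piS'[s Ds <-]; exists (pi s); first exact: piA.
  have [Dc e] := codeP _ (piA _ Ds).
  by congr pi'; apply: piI e; rewrite inE.
have C0 : 0 < c1' / c2 + c1 / c2' by rewrite addr_gt0// divr_gt0.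
exists (c1' / c2 + c1 / c2') => // y z Ay Az.
have [Dy] := codeP _ Ay; have [Dz] := codeP _ Az.
move: (code y) (code z) Dy Dz => s t Ds Dt <- <-.
have [->|/first_difference[n [stn stm]]] := pselect (s = t).
  by rewrite !eucl_dist_xx !mulr0 lexx.
rewrite mulrC ler_pdivrMr// mulrC; apply/andP; split.
  apply: (bound c1 c2' c1 c2' n) (lo' _ _ _ Ds Dt stn) (up _ _ _ Ds Dt stm)
    => //.
  by rewrite lerDr divr_ge0// ltW.
apply: (bound c1 c2 c1' c2' n) (lo _ _ _ Ds Dt stn) (up' _ _ _ Ds Dt stm) => //.
by rewrite lerDl divr_ge0// ltW.
Qed.

End Codings.

Definition digit_sequences {R : realType} (n_ : nat -> nat) (r_ : nat -> R) :
    set (nat -> nat) :=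
  [set s | forall n, (s n < card_set (suffixes n_ r_ n))%N].

Fixpoint code_word (ch : nat -> seq nat -> nat -> seq nat) (s : nat -> nat)
    (n : nat) : seq nat :=
  if n is m.+1 then ch m (code_word ch s m) (s m) else [::].

(** * Enumerations of finite sets *)

Section FiniteSets.

Lemma finite_set_enum {T : choiceType} (A : set T) : finite_set A ->
  exists s : seq T,
    [/\ uniq s, size s = card_set A & forall x, x \in s <-> A x].
Proof.
move=> finA; exists (fset_set A); split=> // x.
by rewrite in_fset_set// inE.
Qed.

(** Concatenating the enumerations gives no repetition because the sets are
    disjoint. This turns the size of a group of components, which is given as a
    sum, into the length of one list of vertices. *)
Lemma disjoint_union_enum {I : eqType} {T : choiceType} (ks : seq I)
    (Z : I -> set T) : uniq ks ->
    (forall k, finite_set (Z k)) ->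
    (forall k l x, Z k x -> Z l x -> k = l) ->
  exists s : seq T, [/\ uniq s, size s = (\sum_(k <- ks) card_set (Z k))%N
    & forall x, x \in s <-> exists2 k, k \in ks & Z k x].
Proof.
move=> + finZ disjZ; elim: ks => [_|k ks IH /= /andP[kks uks]].
  by exists [::]; split=> [||x]; rewrite ?big_nil//; split=> // -[].
have [s [us ss sP]] := IH uks.
have [t [ut st tP]] := finite_set_enum (finZ k).
exists (t ++ s); split=> [||x].
- rewrite cat_uniq ut us andbT/=; apply/hasPn => x /sP[l lks Zlx].
  apply/negP => /tP Zkx; move: kks.
  by rewrite (disjZ _ _ _ Zkx Zlx) lks.
- by rewrite size_cat big_cons st ss.
- rewrite mem_cat; split=> [/orP[/tP Zx|/sP[l lks Zx]]|[l]].
  + by exists k => //; rewrite mem_head.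
  + by exists l => //; rewrite inE lks orbT.
  + rewrite inE => /orP[/eqP->{l} /tP->//|lks Zx].
    by apply/orP; right; apply/sP; exists l.
Qed.

End FiniteSets.

(** * Levels of the augmented tree *)

Definition ratio_prod {R : realType} (r_ : nat -> R) (k : nat) : R :=
  \prod_(1 <= j < k.+1) r_ j.

Lemma exists_expr_lt {R : realType} (x e : R) : 0 <= x < 1 -> 0 < e ->
  exists n, x ^+ n < e.
Proof.
move=> /andP[x0 x1] e0; have nx1 : `|x| < 1 by rewrite ger0_norm.
have /cvgrPdist_lt/(_ _ e0)[n _ /(_ n (leqnn n))] := cvg_expr nx1.
by rewrite /= sub0r normrN ger0_norm ?exprn_ge0//; exists n.
Qed.

Section Levels.
Context {R : realType} {n_ : nat -> nat} {r_ : nat -> R}.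
Hypothesis hdata : moran_data n_ r_.
Hypothesis hr : 0 < inf_ratio r_.

Lemma words_rcons k w j : words n_ k.+1 (rcons w j) <->
  words n_ k w /\ (1 <= j <= n_ k.+1)%N.
Proof.
split=> [[]|[[sw wP] jn]].
  rewrite size_rcons => -[sw] wP; split; first split=> // i ik.
    by have := wP _ (ltnW ik : (i < k.+1)%N); rewrite nth_rcons sw ik.
  by have := wP _ (ltnSn k); rewrite nth_rcons sw ltnn eqxx.
split=> [|i]; first by rewrite size_rcons sw.
rewrite ltnS leq_eqVlt nth_rcons sw => /orP[/eqP->|ik].
  by rewrite ltnn eqxx.
by rewrite ik; exact: wP.
Qed.

Lemma words_take k m w : (m <= k)%N -> words n_ k w -> words n_ m (take m w).
Proof.
move=> mk [sw wP]; split=> [|j jm]; first by rewrite size_takel ?sw.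
by rewrite nth_take//; apply: wP; exact: leq_trans jm mk.
Qed.

Lemma inf_ratio_le k : (1 <= k)%N -> inf_ratio r_ <= r_ k.
Proof.
move=> k1; apply: ge_inf; last by exists k.
by exists 0 => _ [j j1 <-]; have /andP[/ltW] := moran_r_itv hdata j1.
Qed.

Lemma inf_ratio_lt1 : inf_ratio r_ < 1.
Proof.
have /andP[_ r1] := moran_r_itv hdata (leqnn 1).
exact: le_lt_trans (inf_ratio_le (leqnn 1)) r1.
Qed.

Lemma ratio_prod0 : ratio_prod r_ 0 = 1.
Proof. by rewrite /ratio_prod big_geq. Qed.

Lemma ratio_prodS k : ratio_prod r_ k.+1 = ratio_prod r_ k * r_ k.+1.
Proof. by rewrite /ratio_prod big_nat_recr. Qed.

Lemma ratio_prod_gt0 k : 0 < ratio_prod r_ k.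
Proof.
elim: k => [|k IH]; first by rewrite ratio_prod0.
by rewrite ratio_prodS mulr_gt0//; have /andP[] := moran_r_itv hdata (ltn0Sn k).
Qed.

Lemma ratio_prod_le k m : (k <= m)%N -> ratio_prod r_ m <= ratio_prod r_ k.
Proof.
elim: m => [|m IH]; first by rewrite leqn0 => /eqP->.
rewrite leq_eqVlt => /orP[/eqP->//|km].
apply: le_trans (IH km); rewrite ratio_prodS ler_piMr ?ltW ?ratio_prod_gt0//.
by have /andP[] := moran_r_itv hdata (ltn0Sn m).
Qed.

(** Since [n_ k >= 2] and [n_ k * r_ k <= 1], every ratio is at most 1/2. *)
Lemma ratio_prod_le_half k : ratio_prod r_ k <= 2^-1 ^+ k.
Proof.
elim: k => [|k IH]; first by rewrite ratio_prod0 expr0.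
have n2 := moran_n_ge2 hdata (ltn0Sn k).
have nr := moran_nr_le1 hdata (ltn0Sn k).
have /andP[r0 _] := moran_r_itv hdata (ltn0Sn k).
rewrite ratio_prodS exprSr ler_pM ?(ltW (ratio_prod_gt0 k)) ?(ltW r0)//.
rewrite -div1r ler_pdivlMr// mulrC; apply: le_trans nr.
by rewrite ler_wpM2r ?(ltW r0)// (ler_nat _ 2).
Qed.

(** The product of the ratios depends only on the length of a word, so the
    stopping rule that defines the n-th level stops at a single length, the
    least [k] with [ratio_prod r_ k <= r ^+ n]. As every ratio is at least [r],
    that product is still greater than [r ^+ n.+1]: this makes the lengths of
    consecutive levels strictly increase. *)
Lemma level_is_words n : exists k, [/\ level n_ r_ n = words n_ k,
  ratio_prod r_ k <= inf_ratio r_ ^+ n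
  & inf_ratio r_ ^+ n.+1 < ratio_prod r_ k].
Proof.
case: n => [|n].
  exists 0%N; rewrite ratio_prod0 expr0 expr1; split=> //; last first.
    exact: inf_ratio_lt1.
  by apply/seteqP; split=> [w ->|w [/size0nil->]].
set rn := inf_ratio r_ ^+ n.+1.
have rn0 : 0 < rn by rewrite exprn_gt0.
have exk : exists k, ratio_prod r_ k <= rn.
  have half : 0 <= (2^-1 : R) < 1 by rewrite invr_ge0 ler0n invf_lt1 ?ltr1n.
  have [k hk] := exists_expr_lt half rn0.
  by exists k; apply: le_trans (ratio_prod_le_half k) (ltW hk).
case: (ex_minnP exk) => k krn kmin.
have k0 : (0 < k)%N.
  case: k krn kmin => // + _; rewrite ratio_prod0 leNgt.
  by rewrite exprn_ilt1 ?inf_ratio_lt1// ltW.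
have predk : rn < ratio_prod r_ k.-1.
  by rewrite ltNge; apply/negP => /kmin; rewrite leqNgt ltn_predL k0.
exists k; split=> //; last first.
  rewrite -(prednK k0) ratio_prodS [ltLHS]exprSr (prednK k0).
  apply: (@lt_le_trans _ _ (ratio_prod r_ k.-1 * inf_ratio r_)).
    by rewrite ltr_pM2r.
  by rewrite ler_wpM2l ?inf_ratio_le// ltW// ratio_prod_gt0.
apply/seteqP; split=> [w [[m _ [sw wP]] w1 /andP[]]|w [sw wP]].
  rewrite -/(ratio_prod r_ (size w)) => /kmin kw.
  rewrite -[X in \prod_(1 <= _ < X) _](prednK w1) -/(ratio_prod r_ _) => wrn.
  suff wk : (size w <= k)%N.
    have -> : k = size w by apply/eqP; rewrite eqn_leq kw wk.
    by rewrite sw.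
  rewrite leqNgt; apply/negP => kw'; move: wrn; rewrite ltNge => /negP; apply.
  by apply: le_trans krn; apply: ratio_prod_le; rewrite -ltnS (prednK w1).
split; first by exists k.
  by rewrite sw.
rewrite sw; apply/andP; split; first exact: krn.
by rewrite -[X in \prod_(1 <= _ < X) _](prednK k0).
Qed.

Lemma level_lengths : exists K : nat -> nat,
  [/\ forall n, level n_ r_ n = words n_ (K n),
      forall n, (K n < K n.+1)%N
    & forall n, ratio_prod r_ (K n) <= inf_ratio r_ ^+ n].
Proof.
have [K KP] := choice level_is_words.
exists K; split=> n; have [KE Kr rK] := KP n => //.
rewrite ltnNge; apply/negP => /ratio_prod_le.
have [_ Kr' _] := KP n.+1.
by move/le_trans => /(_ _ Kr'); rewrite leNgt rK.
Qed.

End Levels.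

(** * Reflexive transitive closures and paths *)

Section ReflTransPaths.

Lemma clos_refl_trans_path {T : eqType} (e : T -> T -> Prop) x y :
  clos_refl_trans T e x y ->
  exists p, [/\ path [rel u v | `[< e u v >]] x p, last x p = y & uniq (x :: p)].
Proof.
move=> cxy.
have [p [pp <-]] :
    exists p, path [rel u v | `[< e u v >]] x p /\ last x p = y.
  elim: cxy => [u v /asboolP uv|u|u v w _ [p [pp pv]] _ [q [qq qw]]].
  - by exists [:: v]; rewrite /= uv.
  - by exists [::].
  - by exists (p ++ q); rewrite cat_path last_cat pv pp qq.
by case: (shortenP pp) => q qq uq _; exists q.
Qed.

Lemma path_clos_refl_trans {T : eqType} (e : T -> T -> Prop) x p z :
  path [rel u v | `[< e u v >]] x p -> z \in x :: p -> clos_refl_trans T e x z.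
Proof.
elim: p x => [|y p IH] x /=.
  by rewrite mem_seq1 => _ /eqP->; exact: rt_refl.
move=> /andP[/asboolP xy yp]; rewrite inE => /orP[/eqP->|zp].
  exact: rt_refl.
by apply: rt_trans (IH _ yp zp); exact: rt_step.
Qed.

Lemma clos_refl_trans_sym {T : Type} (e : T -> T -> Prop) x y :
  (forall u v, e u v -> e v u) ->
  clos_refl_trans T e x y -> clos_refl_trans T e y x.
Proof.
move=> esym; elim=> [u v /esym uv|u|u v w _ vu _ wv].
- exact: rt_step.
- exact: rt_refl.
- exact: rt_trans wv vu.
Qed.

End ReflTransPaths.

(** * Cells and horizontal components *)

Section MoranStructure.
Context {R : realType} {d : nat} {J : set 'rV[R]_d}.
Context {n_ : nat -> nat} {r_ : nat -> R} {Jf : seq nat -> set 'rV[R]_d}.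
Hypothesis hdata : moran_data n_ r_.
Hypothesis hJ : compact J.
Hypothesis hJ0 : interior J !=set0.
Hypothesis hM : moran_structure J n_ r_ Jf.

Lemma words_all k w : words n_ k w -> all_words n_ w.
Proof. by move=> kw; exists k. Qed.

Lemma moran_cell_prefix k m w : (m <= k)%N -> words n_ k w ->
  Jf w `<=` Jf (take m w).
Proof.
elim: k w => [|k IH] w.
  by rewrite leqn0 => /eqP-> [/size0nil->] _; exact: subset_refl.
case/lastP: w => [|w j]; first by move=> _ [].
rewrite leq_eqVlt => /orP[/eqP-> [wk _]|mk wj].
  by rewrite take_oversize ?wk; [exact: subset_refl|].
have [kw jn] := (words_rcons k w j).1 wj.
apply: (subset_trans (moran_nested hM (ltn0Sn k) kw jn)).
have -> : take m (rcons w j) = take m w.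
  by case: kw => sw _; rewrite -cats1 takel_cat// sw -ltnS.
exact: IH.
Qed.

Lemma diameter_moran_cell k w : words n_ k w ->
  diameter (Jf w) = ratio_prod r_ k * diameter J.
Proof.
elim: k w => [|k IH] w.
  by move=> [/size0nil-> _]; rewrite ratio_prod0 mul1r (moran_root hM).
case/lastP: w => [[]//|w j] /(words_rcons k w j)[kw jn].
have ratio := moran_ratio hM (ltn0Sn k) kw jn.
have /andP[r0 _] := moran_r_itv hdata (ltn0Sn k).
(* division by a zero diameter would give the ratio 0 *)
have dw0 : diameter (Jf w) != 0.
  by apply: contraTneq r0 => dw0; rewrite -ratio dw0 invr0 mulr0 ltxx.
by rewrite ratio_prodS mulrAC -(IH w kw) -ratio mulrC divfK.
Qed.

Lemma eucl_dist_moran_cell k w x y : words n_ k w -> Jf w x -> Jf w y ->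
  eucl_dist x y <= ratio_prod r_ k * diameter J.
Proof.
move=> kw wx wy; rewrite -(diameter_moran_cell kw).
apply: (eucl_dist_le_diameter hJ _ wx wy).
exact/(moran_sub hM)/(words_all kw).
Qed.

Lemma moran_cell_closed k w : words n_ k w -> closed (Jf w).
Proof.
move=> kw; apply: compact_closed; first exact: norm_hausdorff.
have [S simS ->] := moran_similar hM (words_all kw).
exact: similarity_compact.
Qed.

Lemma moran_cell_neq0 k w : words n_ k w -> Jf w !=set0.
Proof.
move=> kw; have [S _ ->] := moran_similar hM (words_all kw).
by have [x /interior_subset Jx] := hJ0; exists (S x); exists x.
Qed.

Lemma diameter_ge0 : 0 <= diameter J.
Proof.
have [x /interior_subset Jx] := hJ0; rewrite -(eucl_dist_xx x).
exact: (eucl_dist_le_diameter hJ).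
Qed.

Hypothesis hr : 0 < inf_ratio r_.
Context (K : nat -> nat).
Hypothesis levelE : forall n, level n_ r_ n = words n_ (K n).
Hypothesis K_lt : forall n, (K n < K n.+1)%N.
Hypothesis K_ratio : forall n, ratio_prod r_ (K n) <= inf_ratio r_ ^+ n.

Local Notation level := (level n_ r_).
Local Notation r := (inf_ratio r_).
Local Notation branching n := (card_set (suffixes n_ r_ n)).
Local Notation connected n :=
  (clos_refl_trans (seq nat) (horizontal_edge n_ r_ Jf n)).

Lemma connected_sym n u v : connected n u v -> connected n v u.
Proof.
apply: clos_refl_trans_sym => {}u {}v [n1 lu lv uv [x [ux vx]]].
by split=> //; [exact/nesym|exists x].
Qed.

Lemma connected_level n u v : connected n u v -> level n u -> level n v.
Proof. by elim=> [{}u {}v []//|//|{}u {}v w _ uv _ vw /uv/vw]. Qed.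

Lemma level0_nil u : level 0 u -> u = [::].
Proof. by []. Qed.

(** Level 0 has no horizontal edge, but it has a single vertex. *)
Lemma connected_meet n u v x : level n u -> level n v -> Jf u x -> Jf v x ->
  connected n u v.
Proof.
case: n => [/level0_nil-> /level0_nil-> *|n lu lv ux vx]; first exact: rt_refl.
have [->|/eqP uv] := eqVneq u v; first exact: rt_refl.
by apply: rt_step; split=> //; exists x.
Qed.

Definition parent n (w : seq nat) := take (K n) w.

Lemma parent_level n w : level n.+1 w -> level n (parent n w).
Proof. by rewrite !levelE; apply: words_take; exact/ltnW. Qed.

Lemma parent_cell n w : level n.+1 w -> Jf w `<=` Jf (parent n w).
Proof. by rewrite levelE; apply: moran_cell_prefix; exact/ltnW. Qed.

(** Cells that meet lie in parent cells that meet, so the parent map sends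
    components into components. *)
Lemma connected_parent n u v : connected n.+1 u v ->
  connected n (parent n u) (parent n v).
Proof.
elim=> [{}u {}v [_ lu lv _ [x [ux vx]]]|{}u|{}u {}v w _ uv _ vw].
- exact: connected_meet (parent_level lu) (parent_level lv)
    (parent_cell lu ux) (parent_cell lv vx).
- exact: rt_refl.
- exact: rt_trans uv vw.
Qed.

Lemma eucl_dist_level n u x y : level n u -> Jf u x -> Jf u y ->
  eucl_dist x y <= r ^+ n * diameter J.
Proof.
rewrite levelE => lu ux uy; apply: le_trans (eucl_dist_moran_cell lu ux uy) _.
by rewrite ler_wpM2r// diameter_ge0.
Qed.

(** Two points in cells of one component are joined by a chain of cells without
    repetition, hence of at most [M] cells, each of diameter at most [r ^+ n]
    times that of [J]. The chain is measured in the sup norm, which is bounded by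
    the Euclidean distance. *)
Lemma norm_component_le (M : nat) n u v x y :
  (forall T, components n_ r_ Jf n T -> finite_set T /\ (card_set T <= M)%N) ->
  level n u -> connected n u v -> Jf u x -> Jf v y ->
  `|x - y| <= M%:R * (r ^+ n * diameter J).
Proof.
move=> compM lu cuv ux vy.
have D0 : 0 <= r ^+ n * diameter J.
  by rewrite mulr_ge0 ?diameter_ge0// exprn_ge0// ltW.
have chain p : forall w z, level n w -> Jf w z ->
    path [rel u v | `[< horizontal_edge n_ r_ Jf n u v >]] w p ->
    Jf (last w p) y -> `|z - y| <= (size p).+1%:R * (r ^+ n * diameter J).
  elim: p => [|w' p IH] w z lw wz /=.
    move=> _ wy; rewrite mul1r.
    exact: le_trans (norm_le_eucl_dist z y) (eucl_dist_level lw wz wy).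
  move=> /andP[/asboolP[_ _ lw' _ [t [wt w't]]] w'p] py.
  rewrite -(subrKA t) (le_trans (ler_normD _ _))//.
  rewrite -[(size p).+2]add1n natrD mulrDl lerD//.
    rewrite mul1r.
    exact: le_trans (norm_le_eucl_dist z t) (eucl_dist_level lw wz wt).
  exact: IH w'p py.
have [p [up pv uniqp]] := clos_refl_trans_path cuv.
have [|finT cardT] := compM (component n_ r_ Jf n u); first by exists u.
have sp : ((size p).+1 <= M)%N.
  apply: leq_trans cardT; have [s [_ <- sP]] := finite_set_enum finT.
  apply: (uniq_leq_size uniqp) => w wp; apply/sP.
  have cuw := path_clos_refl_trans up wp.
  by split=> //; exact: connected_level cuw lu.
apply: (@le_trans _ _ ((size p).+1%:R * (r ^+ n * diameter J))).
  by apply: (chain p u) => //; rewrite pv.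
by rewrite ler_wpM2r// ler_nat.
Qed.

(** * Rearranging the tree *)

Lemma component_eq n u v : connected n u v ->
  component n_ r_ Jf n u = component n_ r_ Jf n v.
Proof.
move=> uv; apply/seteqP; split=> w [lw cw]; split=> //.
  exact: rt_trans (connected_sym uv) cw.
exact: rt_trans uv cw.
Qed.

Lemma component_connected n T u v : components n_ r_ Jf n T -> T u ->
  T v <-> connected n u v.
Proof.
move=> [w lw <-] [lu wu]; split=> [[lv wv]|uv].
  exact: rt_trans (connected_sym wu) wv.
by split; [exact: connected_level uv lu|exact: rt_trans wu uv].
Qed.

Lemma component_level n T u : components n_ r_ Jf n T -> T u -> level n u.
Proof. by move=> [w _ <-] []. Qed.

Lemma offspringE n T v : T `<=` level n ->
  offspring n_ r_ n T v <-> level n.+1 v /\ T (parent n v).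
Proof.
move=> Tn; split=> [[lv [u [i [Tu _ vE]]]]|[lv Tv]]; split=> //.
  suff -> : parent n v = u by [].
  have := Tn _ Tu; rewrite levelE => -[su _].
  by rewrite /parent vE -su take_size_cat.
exists (parent n v), (drop (K n) v); split=> //; rewrite ?cat_take_drop//.
by exists (parent n v); [exact: Tn|rewrite cat_take_drop].
Qed.

(** [g u] lists the group that becomes the set of children of [u]. *)
Definition rearranging n (T : set (seq nat)) (g : seq nat -> seq (seq nat)) :=
  [/\ forall u, T u -> uniq (g u) /\ size (g u) = branching n,
      forall u v, T u -> v \in g u -> level n.+1 v /\ T (parent n v),
      forall v, level n.+1 v -> T (parent n v) -> exists2 u, T u & v \in g u
    & forall u u' v v', T u -> T u' -> v \in g u -> v' \in g u' ->
        connected n.+1 v v' -> u = u'].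

(** The indices of the groups of [T] and the vertices of [T] are both
    enumerated by the ordinals below [card_set T]; this attaches a group to each
    vertex. A component of the next level is a single [Z k] and the [Lam s] are
    disjoint, so it never meets two groups. *)
Lemma rearranged_groups n T :
  rearrangeable n_ r_ Jf -> components n_ r_ Jf n T ->
  exists g, rearranging n T g.
Proof.
move=> [[M compM] rearr] compT.
have [finT _] := compM _ _ compT.
have [p [Z [Lam [Zinj rangeZ Lamdisj offE sumE]]]] := rearr _ _ compT.
have Tn : T `<=` level n by move=> u; exact: component_level.
have compZ k : components n_ r_ Jf n.+1 (Z k).
  by have : range Z (Z k) by [exists k]; rewrite rangeZ => -[].
have Zdisj k l v v' : Z k v -> Z l v' -> connected n.+1 v v' -> k = l.
  move=> kv lv' vv'; apply: Zinj.
  have kv' : Z k v' by apply/(component_connected v' (compZ k) kv).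
  apply/seteqP; split=> x.
    move/(component_connected x (compZ k) kv').
    by move/(component_connected x (compZ l) lv').
  move/(component_connected x (compZ l) lv').
  by move/(component_connected x (compZ k) kv').
have [t [ut st tP]] := finite_set_enum finT.
have /choice[S SP] : forall s, exists q : seq (seq nat),
    [/\ uniq q, size q = branching n
      & forall v, v \in q <-> exists2 k, k \in Lam s & Z k v].
  move=> s.
  have [||q [uq sq qP]] := @disjoint_union_enum _ _ _ Z (enum_uniq (Lam s)).
  - by move=> k; have [] := compM _ _ (compZ k).
  - by move=> k l x kx lx; apply: Zdisj kx lx (rt_refl _ _ _).
  exists q; split=> //; first by rewrite sq -(sumE s) big_enum.
  move=> v; split=> [/qP[k ks kv]|[k ks kv]].
    by exists k => //; rewrite mem_enum in ks.
  by apply/qP; exists k => //; rewrite mem_enum.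
have tlt u : T u -> (index u t < card_set T)%N.
  by move=> /tP; rewrite -st index_mem.
exists (fun u => oapp S [::] (insub (index u t))).
have gE u (Tu : T u) : oapp S [::] (insub (index u t)) = S (Ordinal (tlt u Tu)).
  case: insubP => [s _ sE|/negP]; last by move/(_ (tlt u Tu)).
  by congr (S _); exact: val_inj.
split=> [u Tu|u v Tu|v lv Tv|u u' v v' Tu Tu'].
- by rewrite gE; have [] := SP (Ordinal (tlt u Tu)).
- rewrite gE; have [_ _ SuP] := SP (Ordinal (tlt u Tu)) => /SuP[k ks kv].
  apply/(offspringE v Tn); rewrite offE.
  by exists (Ordinal (tlt u Tu)) => //; exists k.
- have : offspring n_ r_ n T v by apply/(offspringE v Tn).
  rewrite offE => -[s _ [k ks kv]].
  have sT : T (nth [::] t s) by apply/tP; rewrite mem_nth// st.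
  exists (nth [::] t s) => //; rewrite gE.
  have -> : Ordinal (tlt _ sT) = s.
    by apply: val_inj; rewrite /= index_uniq// st.
  by have [_ _ SsP] := SP s; apply/SsP; exists k.
- rewrite !gE; set s := Ordinal (tlt u Tu); set s' := Ordinal (tlt u' Tu').
  have [_ _ SsP] := SP s; have [_ _ SsP'] := SP s'.
  move=> /SsP[k ks kv] /SsP'[l ls lv'] vv'.
  have kl := Zdisj _ _ _ _ kv lv' vv'; rewrite -kl in ls.
  have ss' : s = s' by apply: (Lamdisj s s') => //; exists k.
  have idx : index u t = index u' t by have := congr1 val ss'.
  rewrite -(nth_index [::] ((tP u).2 Tu)) idx.
  by rewrite (nth_index [::] ((tP u').2 Tu')).
Qed.

(** The children of [u] are listed by the rearrangement of its own component.
    If children of [u] and [u'] are connected, then so are their parents in the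
    original tree, hence [u] and [u'] share a component and the separation of
    the groups inside it applies. *)
Lemma rearranged_children n : rearrangeable n_ r_ Jf ->
  exists ch : seq nat -> nat -> seq nat,
  [/\ forall u i, level n u -> (i < branching n)%N ->
        level n.+1 (ch u i) /\ connected n u (parent n (ch u i)),
      forall v, level n.+1 v -> exists u i,
        [/\ level n u, (i < branching n)%N & ch u i = v],
      forall u u' i i', level n u -> level n u' ->
        (i < branching n)%N ->
        (i' < branching n)%N ->
        connected n.+1 (ch u i) (ch u' i') -> u = u'
    & forall u i i', level n u -> (i < branching n)%N ->
        (i' < branching n)%N -> ch u i = ch u i' -> i = i'].
Proof.
move=> rearr.
have /choice[g gP] : forall T, exists g,
    components n_ r_ Jf n T -> rearranging n T g.
  move=> T; have [cT|cT] := pselect (components n_ r_ Jf n T).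
    by have [g gP] := rearranged_groups rearr cT; exists g.
  by exists (fun=> [::]).
pose comp u := component n_ r_ Jf n u.
have compP u : level n u -> components n_ r_ Jf n (comp u) by exists u.
have compu u : level n u -> comp u u by split=> //; exact: rt_refl.
exists (fun u i => nth [::] (g (comp u) u) i).
have ch_in u i : level n u -> (i < branching n)%N ->
    nth [::] (g (comp u) u) i \in g (comp u) u.
  move=> lu iN; have [sz _ _ _] := gP _ (compP u lu).
  by have [_ sg] := sz _ (compu u lu); rewrite mem_nth// sg.
have ch_comp u i : level n u -> (i < branching n)%N ->
    level n.+1 (nth [::] (g (comp u) u) i) /\
    connected n u (parent n (nth [::] (g (comp u) u) i)).
  move=> lu iN; have [_ par _ _] := gP _ (compP u lu).
  by have [lv [_ uv]] := par _ _ (compu u lu) (ch_in u i lu iN).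
split=> //.
- move=> v lv; have lpv := parent_level lv.
  have [sz _ cov _] := gP _ (compP _ lpv).
  have [u pu vu] := cov v lv (compu _ lpv).
  have lu := component_level (compP _ lpv) pu.
  have cu : comp u = comp (parent n v) by have [_ /component_eq] := pu.
  exists u, (index v (g (comp u) u)); rewrite cu nth_index//; split=> //.
  by have [_ <-] := sz _ pu; rewrite index_mem.
- move=> u u' i i' lu lu' iN i'N vv'.
  have [lv uv] := ch_comp _ _ lu iN; have [lv' uv'] := ch_comp _ _ lu' i'N.
  have uu' : connected n u u'.
    apply: rt_trans uv (rt_trans _ _ _ _ _ (connected_parent vv') _).
    exact: connected_sym.
  have [_ _ _ sep] := gP _ (compP u lu).
  apply: sep (ch_in _ _ lu iN) _ vv'; [exact: compu| |].
    by split.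
  by have := ch_in _ _ lu' i'N; rewrite /comp -(component_eq uu').
- move=> u i i' lu iN i'N /eqP.
  have [sz _ _ _] := gP _ (compP u lu); have [ug sg] := sz _ (compu u lu).
  by rewrite nth_uniq ?sg// => /eqP.
Qed.

(** * Coding the Moran set *)

Lemma length_ge n : (n <= K n)%N.
Proof. by elim: n => // n IH; apply: leq_ltn_trans IH (K_lt n). Qed.

Section Coding.
Hypothesis hsep : separation_condition n_ r_ Jf.
Hypothesis hre : rearrangeable n_ r_ Jf.
Context (ch : nat -> seq nat -> nat -> seq nat).
Hypothesis ch_parent : forall n u i, level n u ->
  (i < branching n)%N ->
  level n.+1 (ch n u i) /\ connected n u (parent n (ch n u i)).
Hypothesis ch_cover : forall n v, level n.+1 v -> exists u i,
  [/\ level n u, (i < branching n)%N & ch n u i = v].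
Hypothesis ch_sep : forall n u u' i i', level n u -> level n u' ->
  (i < branching n)%N -> (i' < branching n)%N ->
  connected n.+1 (ch n u i) (ch n u' i') -> u = u'.
Hypothesis ch_inj : forall n u i i', level n u ->
  (i < branching n)%N -> (i' < branching n)%N ->
  ch n u i = ch n u i' -> i = i'.

Local Notation W := (code_word ch).

(** [x] lies in the cells of the component of [W s n], for every [n]. The cell
    of [W s n] itself need not contain [x]: the cells of [W s n.+1] and [W s n]
    are only related through their components. *)
Definition codes (s : nat -> nat) (x : 'rV[R]_d) : Prop :=
  forall n, exists v, connected n (W s n) v /\ Jf v x.

Lemma code_word_level s n : digit_sequences n_ r_ s -> level n (W s n).
Proof.
move=> Ds; elim: n => // n IH.
by have [] := ch_parent IH (Ds n).
Qed.

(** The child of [u] lies over the component of [u] by [ch_parent], so the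
    components of the [W s n] decrease. *)
Lemma code_word_nested s n m v x : digit_sequences n_ r_ s -> (n <= m)%N ->
  connected m (W s m) v -> Jf v x ->
  exists v', connected n (W s n) v' /\ Jf v' x.
Proof.
move=> Ds; elim: m v => [|m IH] v.
  by rewrite leqn0 => /eqP->; exists v.
rewrite leq_eqVlt => /orP[/eqP->|nm] cv vx; first by exists v.
have [lc cc] := ch_parent (code_word_level m Ds) (Ds m).
apply: (IH (parent m v)) => //.
  exact: rt_trans cc (connected_parent cv).
by apply: parent_cell vx; exact: connected_level cv lc.
Qed.

Lemma code_word_prefix s t n : (forall m, (m < n)%N -> s m = t m) ->
  W s n = W t n.
Proof.
elim: n => //= n IH st; rewrite IH; first by rewrite (st n).
by move=> m mn; apply: st; exact: ltnW.
Qed.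

Lemma component_cells_closed n u : level n u ->
  closed (\bigcup_(v in component n_ r_ Jf n u) Jf v).
Proof.
move=> lu; apply: closed_bigcup.
  have [[M compM] _] := hre.
  by have [|] := compM n (component n_ r_ Jf n u); [exists u|].
by move=> v [lv _]; move: lv; rewrite levelE; exact: moran_cell_closed.
Qed.

(** Any cluster point of points chosen in the cells [Jf (W s n)]: from the index
    [n] on, these points stay in the closed union of the cells of the [n]-th
    component. *)
Lemma exists_coded_point s : digit_sequences n_ r_ s -> exists x, codes s x.
Proof.
move=> Ds; have /choice[z zP] : forall n, exists x, Jf (W s n) x.
  move=> n; have := code_word_level n Ds; rewrite levelE.
  by move=> /moran_cell_neq0[x Jx]; exists x.
have zJ : (z @ \oo) J.
  exists 0%N => // n _ /=; have := code_word_level n Ds; rewrite levelE => lw.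
  exact: (moran_sub hM (words_all lw)).
have [x [_ clx]] := hJ _ zJ.
exists x => n; have lw := code_word_level n Ds.
suff [v [_ cv] vx] : (\bigcup_(v in component n_ r_ Jf n (W s n)) Jf v) x.
  by exists v.
apply: (component_cells_closed lw) => B xB; apply: (clx _ B _ xB).
exists n => // m /= nm.
have [v [cv vz]] := code_word_nested Ds nm (rt_refl _ _ _) (zP m).
by exists v => //; split=> //; exact: connected_level cv lw.
Qed.

Lemma codes_moran_set s x :
  digit_sequences n_ r_ s -> codes s x -> moran_set n_ Jf x.
Proof.
move=> Ds sx k _; have [v [cv vx]] := sx k.
have := connected_level cv (code_word_level k Ds); rewrite levelE => lv.
exists (take k v); first by apply: words_take lv; exact: length_ge.
by apply: moran_cell_prefix lv _ vx; exact: length_ge.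
Qed.

Lemma codes_upper_bound : exists2 c : R, 0 < c &
  forall s t x y n, digit_sequences n_ r_ s -> codes s x -> codes t y ->
    W s n = W t n -> eucl_dist x y <= c * r ^+ n.
Proof.
have [[M compM] _] := hre.
exists (d%:R * (M%:R * diameter J) + 1).
  by rewrite ltr_wpDl// !mulr_ge0// diameter_ge0.
move=> s t x y n Ds sx ty st.
have [u [su ux]] := sx n; have [v [tv vy]] := ty n.
apply: (le_trans (eucl_dist_le_norm x y)).
have uv : connected n u v by apply: rt_trans (connected_sym su) _; rewrite st.
have lu := connected_level su (code_word_level n Ds).
have := norm_component_le (compM n) lu uv ux vy.
have r0 : 0 < r ^+ n by rewrite exprn_gt0.
move=> xy; apply: (@le_trans _ _ (d%:R * (M%:R * (r ^+ n * diameter J)))).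
  by rewrite ler_wpM2l.
by rewrite mulrDl mul1r -!mulrA [diameter J * _]mulrC lerDl ltW.
Qed.

Lemma code_word_inj s t n :
  digit_sequences n_ r_ s -> digit_sequences n_ r_ t ->
  W s n.+1 = W t n.+1 -> s n = t n.
Proof.
move=> Ds Dt st; have ls := code_word_level n Ds.
have lt := code_word_level n Dt.
have Wst : W s n = W t n.
  apply: (ch_sep ls lt (Ds n) (Dt n)).
  by rewrite -[ch n _ _]/(W s n.+1) st; exact: rt_refl.
by apply: (ch_inj ls (Ds n) (Dt n)); move: st => /=; rewrite Wst.
Qed.

(** The digits at [n] affect the vertex [W s n.+1], and by [ch_sep] the
    components of the next vertices [W s n.+2] detect that vertex; hence the two
    levels of delay in the constant. *)
Lemma codes_lower_bound : exists2 c : R, 0 < c &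
  forall s t x y n, digit_sequences n_ r_ s -> digit_sequences n_ r_ t ->
    codes s x -> codes t y -> s n <> t n -> c * r ^+ n <= eucl_dist x y.
Proof.
have [C C0 sepC] := hsep.
exists (C * r ^+ 2); first by rewrite mulr_gt0// exprn_gt0.
move=> s t x y n Ds Dt sx ty stn.
have [u [su ux]] := sx n.+2; have [v [tv vy]] := ty n.+2.
have lu := connected_level su (code_word_level n.+2 Ds).
have lv := connected_level tv (code_word_level n.+2 Dt).
have nuv : ~ connected n.+2 u v.
  move=> uv; apply: stn; apply: code_word_inj => //.
  apply: (ch_sep (code_word_level n.+1 Ds) (code_word_level n.+1 Dt)
    (Ds n.+1) (Dt n.+1)).
  exact: rt_trans su (rt_trans _ _ _ _ _ uv (connected_sym tv)).
have [//|[z [uz vz]]|far] := sepC n.+2 u v _ lu lv.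
  by case: nuv; exact: connected_meet lu lv uz vz.
rewrite -mulrA -exprD addSn add1n; apply: (le_trans far).
exact: set_dist_le.
Qed.

(** The digits of a point are read from the components of cells [u n] that
    contain it: [q n] is the vertex whose group contains [u n.+1], hence
    the whole component of [u n.+1], in particular [q n.+1]. *)
Lemma exists_code x : moran_set n_ Jf x ->
  exists2 s, digit_sequences n_ r_ s & codes s x.
Proof.
move=> Ex; have /choice[u uP] : forall n, exists v, level n v /\ Jf v x.
  by move=> n; have [v wv vx] := Ex (K n) I; exists v; rewrite levelE.
have /choice[q qP] : forall n, exists v, level n v /\
    exists2 i, (i < branching n)%N & ch n v i = u n.+1.
  move=> n; have [v [i [lv iN e]]] := ch_cover (uP n.+1).1.
  by exists v; split=> //; exists i.
have qu n : connected n (q n) (u n).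
  have [lq [i iN e]] := qP n; have [_ qpu] := ch_parent lq iN.
  rewrite e in qpu; apply: rt_trans qpu _.
  have [lu ux] := uP n; have [lu' ux'] := uP n.+1.
  exact: connected_meet (parent_level lu') lu (parent_cell lu' ux') ux.
have /choice[s sP] : forall n, exists i,
    (i < branching n)%N /\ ch n (q n) i = q n.+1.
  move=> n; have [v [i [lv iN e]]] := ch_cover (qP n.+1).1.
  exists i; split=> //; suff -> : q n = v by [].
  have [lq [j jN e']] := qP n; apply: (ch_sep lq lv jN iN).
  by rewrite e e'; exact/connected_sym/qu.
have Ds : digit_sequences n_ r_ s by move=> n; have [] := sP n.
have Wq n : W s n = q n.
  elim: n => [|n /= ->]; first by rewrite (level0_nil (qP 0%N).1).
  by have [] := sP n.
by exists s => // n; exists (u n); rewrite Wq; split=> //; have [] := uP n.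
Qed.

(** Injectivity comes from the lower bound; surjectivity holds because a point
    and the point coded by its digits are at distance at most [c1 * r ^+ n] for
    all [n]. *)
Lemma codes_metric_coding :
  exists pi, metric_coding (digit_sequences n_ r_) (moran_set n_ Jf) r pi.
Proof.
have [c1 c10 up] := codes_upper_bound; have [c2 c20 lo] := codes_lower_bound.
have /choice[pi piP] : forall s, exists x, digit_sequences n_ r_ s -> codes s x.
  move=> s; have [|nDs] := pselect (digit_sequences n_ r_ s).
    by move/exists_coded_point => [x sx]; exists x.
  by exists 0.
exists pi; split; last first.
  exists c1, c2; split=> // [s t n Ds Dt st|s t n Ds Dt].
    by apply: (up s t) => //; [exact: piP|exact: piP|exact: code_word_prefix].
  by apply: (lo s t) => //; exact: piP.
split=> [s Ds|s t|x Ex].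
- by apply: codes_moran_set (piP _ Ds).
- rewrite !inE => Ds Dt e; apply: contrapT => /first_difference[n [stn _]].
  have := lo _ _ _ _ _ Ds Dt (piP _ Ds) (piP _ Dt) stn.
  by rewrite e eucl_dist_xx leNgt mulr_gt0// exprn_gt0.
- have [s Ds sx] := exists_code Ex; exists s => //.
  apply: eucl_dist_eq0; rewrite leNgt; apply/negP => pos.
  have r01 : 0 <= r < 1 by rewrite ltW//= (inf_ratio_lt1 hdata).
  have [n rn] := exists_expr_lt r01 (divr_gt0 pos c10).
  have := up _ _ _ _ n Ds (piP _ Ds) sx erefl.
  by rewrite leNgt mulrC -ltr_pdivlMr// rn.
Qed.

End Coding.

End MoranStructure.

Lemma rearrangeable_metric_coding {R : realType} {d : nat} (J : set 'rV[R]_d)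
    (n_ : nat -> nat) (r_ : nat -> R) (Jf : seq nat -> set 'rV[R]_d) :
  moran_data n_ r_ -> compact J -> interior J !=set0 ->
  moran_structure J n_ r_ Jf -> 0 < inf_ratio r_ ->
  separation_condition n_ r_ Jf -> rearrangeable n_ r_ Jf ->
  exists pi, metric_coding (digit_sequences n_ r_) (moran_set n_ Jf)
    (inf_ratio r_) pi.
Proof.
move=> hdata hJ hJ0 hM hr hsep hre.
have [K [levelE K_lt K_ratio]] := level_lengths hdata hr.
have /choice[ch chP] := fun n => rearranged_children hM levelE K_lt n hre.
apply: (codes_metric_coding hdata hJ hJ0 hM hr levelE K_lt K_ratio hsep hre
  (ch := ch)); by move=> n; case: (chP n).
Qed.

Theorem theorem4p6 (R : realType) (d : nat) (J : set 'rV[R]_d)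
    (n_ : nat -> nat) (r_ : nat -> R) (Jf Jf' : seq nat -> set 'rV[R]_d)
    (hdata : moran_data n_ r_)
    (hJ : compact J) (hJ0 : interior J !=set0)
    (hM : moran_structure J n_ r_ Jf) (hM' : moran_structure J n_ r_ Jf')
    (hr : 0 < inf_ratio r_)
    (hsep : separation_condition n_ r_ Jf) (hsep' : separation_condition n_ r_ Jf')
    (hre : rearrangeable n_ r_ Jf) (hre' : rearrangeable n_ r_ Jf') :
  lipschitz_equivalent (moran_set n_ Jf) (moran_set n_ Jf').
Proof.
have [pi cod] := rearrangeable_metric_coding hdata hJ hJ0 hM hr hsep hre.
have [pi' cod'] := rearrangeable_metric_coding hdata hJ hJ0 hM' hr hsep' hre'.
exact: metric_coding_lipschitz hr cod cod'.
Qed.
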